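(* Let $f:L\rightarrow M$ be an open localic map that sends dense elements of $L$ to dense elements of $M$. Then $f$ preserves maximal nowhere dense sublocales; that is, if $N$ is a maximal nowhere dense sublocale of $L$, then the image $f[N]$ is a maximal nowhere dense sublocale of $M$.
   Context: A localic map $f:L\to M$ is an infimum-preserving map between locales whose left adjoint $f^*:M\to L$ preserves finite meets. For a sublocale $S$ of $L$, the set-theoretic image $f[S]$ is a sublocale of $M$; $f$ is open if $f[S]$ is an open sublocale of $M$ for every open sublocale $S$ of $L$. An element $a$ of a locale is dense if $a^*=a\to 0=0$. $\mathsf{O}=\{1\}$ is the void sublocale. A sublocale $N$ of $L$ is nowhere dense if $N\cap\mathfrak{B}L=\mathsf{O}$, where $\mathfrak{B}L=\{x\to 0:x\in L\}$. For a sublocale $S$ of $L$, ''$N$ is nowhere dense in $S$'' means $N\subseteq S$ and $N$ is a nowhere dense sublocale of the locale $S$. A nowhere dense sublocale $N$ of $L$ is maximal nowhere dense if there is no nowhere dense sublocale $S$ of $L$ such that $N$ is nowhere dense in $S$. *)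

(* Defs.v *)
From HB Require Import structures.
#[warning="-notation-overridden"] From mathcomp Require Import all_boot all_order.
From mathcomp Require Import boolp classical_sets.

Set Warnings "-redundant-canonical-projection,-projection-no-head-constant".
Set Implicit Arguments.
Unset Strict Implicit.
Unset Printing Implicit Defensive.

Import Order.TTheory.

Local Open Scope classical_set_scope.

(* In classical_set_scope, `&` is set intersection; lattice meets are written
   with the delimiter %O. *)

HB.mixin Record isLocale (d : Order.disp_t) L of Order.TBLattice d L := {
  lsup : set L -> L;
  lsup_supremums : forall A : set L, supremums A (lsup A);
  meet_lsup : forall (x : L) (A : set L),
    (x `&` lsup A)%O = lsup [set (x `&` a)%O | a in A]
}.

#[short(type="localeType")]
HB.structure Definition Locale (d : Order.disp_t) :=
  { L of isLocale d L & Order.TBLattice d L }.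

Section LocaleOps.
Context (d : Order.disp_t) (L : localeType d).
Implicit Types (x y z : L) (A : set L).

Lemma lsup_ub A x : A x -> (x <= lsup A)%O.
Proof. by have [ubA _] := lsup_supremums A; exact: ubA. Qed.

Lemma lsup_le A x : ubound A x -> (lsup A <= x)%O.
Proof. by have [_ leA] := lsup_supremums A; exact: leA. Qed.

Definition linf A : L := lsup (lbound A).

Lemma linf_lb A x : A x -> (linf A <= x)%O.
Proof. by move=> Ax; apply: lsup_le => y; exact. Qed.

Lemma linf_ge A x : lbound A x -> (x <= linf A)%O.
Proof. exact: lsup_ub. Qed.

Lemma linf_infimums A : infimums A (linf A).
Proof. by split=> x; [exact: linf_lb | exact: linf_ge]. Qed.

(* The Heyting implication x -> y. *)
Definition limp x y : L := lsup [set z | (z `&` x <= y)%O].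

Lemma le_limp x y z : (z <= limp x y)%O = (z `&` x <= y)%O.
Proof.
apply/idP/idP => [zxy|]; last by move=> ?; exact: lsup_ub.
apply: (@le_trans _ _ (limp x y `&` x)%O); first by rewrite leI2.
rewrite meetC meet_lsup; apply: lsup_le => _ [w wxy <-].
by rewrite meetC.
Qed.

Definition pcompl x : L := limp x \bot%O.

Definition dense x := pcompl x = \bot%O.

Definition is_sublocale (S : set L) :=
  (forall A, A `<=` S -> S (linf A)) /\ (forall x s, S s -> S (limp x s)).

Record sublocale := Sublocale {
  sublocale_set :> set L;
  sublocaleP : is_sublocale sublocale_set
}.

(* The underlying set of the open sublocale o(a). *)
Definition open_set (a : L) : set L := [set limp a x | x in setT].

Definition is_open_sublocale (S : sublocale) := exists a, S = open_set a :> set L.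

Definition void_set : set L := [set \top%O].

(* The underlying set of the Booleanization of L. *)
Definition booleanization : set L := [set pcompl x | x in setT].

Definition nowhere_dense (N : sublocale) := N `&` booleanization = void_set.

End LocaleOps.

Arguments sublocale {d} L.

(* A sublocale of L as a locale, with the order inherited from L. Meets and
   the top are those of L; joins and the bottom in general are not. *)
Definition sub_locale (d : Order.disp_t) (L : localeType d) (S : sublocale L) :
  Type := set_type S.

Section SubLocale.
Context (d : Order.disp_t) (L : localeType d) (S : sublocale L).
Local Notation T := (sub_locale S).

HB.instance Definition _ := SubChoice.copy T (set_type S).
HB.instance Definition _ := [SubChoice_isSubPOrder of T by <: with d].

Implicit Types (x y : T) (A : set T).

Lemma sub_localeP x : sublocale_set S (\val x).
Proof. exact/set_mem/(valP x). Qed.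

Definition sub_of (a : L) (Sa : sublocale_set S a) : T := Sub a (mem_set Sa).

Lemma sub_ofK a (Sa : sublocale_set S a) : \val (sub_of Sa) = a.
Proof. exact: SubK. Qed.

Lemma sub_leE x y : (x <= y)%O = (\val x <= \val y)%O.
Proof. by rewrite Order.le_val. Qed.

Fact sub_sup_subproof A :
  sublocale_set S (linf [set u | sublocale_set S u /\ forall a, A a -> (\val a <= u)%O]).
Proof. by case: (sublocaleP S) => Sinf _; apply: Sinf => u []. Qed.

Definition sub_sup A : T := sub_of (sub_sup_subproof A).

Lemma sub_sup_supremums A : supremums A (sub_sup A).
Proof.
split=> [a Aa|u Au]; rewrite sub_leE sub_ofK.
  by apply: linf_ge => u [_]; exact.
apply: linf_lb; split; first exact: sub_localeP.
by move=> a /Au; rewrite sub_leE.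
Qed.

Fact sub_meet_subproof x y : sublocale_set S (\val x `&` \val y)%O.
Proof.
have [Sinf _] := sublocaleP S.
suff -> : (\val x `&` \val y)%O = linf [set \val x; \val y].
  by apply: Sinf => _ [] ->; exact: sub_localeP.
apply/le_anti/andP; split.
  by apply: linf_ge => _ [] ->; [exact: leIl | exact: leIr].
by rewrite lexI !linf_lb //=; [right | left].
Qed.

Definition sub_meet x y : T := sub_of (sub_meet_subproof x y).
Definition sub_join x y : T := sub_sup [set x; y].

Fact sub_top_subproof : sublocale_set S \top%O.
Proof.
have [Sinf _] := sublocaleP S.
have -> : \top%O = linf (@set0 L); last exact: Sinf.
by apply/le_anti; rewrite lex1 andbT; exact: linf_ge.
Qed.

Fact sub_lexI x y z : (x <= sub_meet y z)%O = (x <= y)%O && (x <= z)%O.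
Proof. by rewrite !sub_leE sub_ofK lexI. Qed.

Fact sub_leUx x y z : (sub_join x y <= z)%O = (x <= z)%O && (y <= z)%O.
Proof.
have [ub le] := sub_sup_supremums [set x; y].
apply/idP/andP => [xyz|[xz yz]]; last by apply: le => _ [] ->.
by split; apply: le_trans xyz; apply: ub; [left | right].
Qed.

HB.instance Definition _ :=
  Order.POrder_isMeetSemilattice.Build d T sub_lexI.
HB.instance Definition _ :=
  Order.POrder_isJoinSemilattice.Build d T sub_leUx.

Fact sub_le0x x : (sub_sup set0 <= x)%O.
Proof. by have [_] := sub_sup_supremums set0; exact. Qed.

Fact sub_lex1 x : (x <= sub_of sub_top_subproof)%O.
Proof. by rewrite sub_leE sub_ofK lex1. Qed.

HB.instance Definition _ := Order.hasBottom.Build d T sub_le0x.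
HB.instance Definition _ := Order.hasTop.Build d T sub_lex1.

Fact sub_meet_sup x A :
  (x `&` sub_sup A)%O = sub_sup [set (x `&` a)%O | a in A].
Proof.
have [ubA leA] := sub_sup_supremums A.
have [ubB leB] := sub_sup_supremums [set (x `&` a)%O | a in A].
apply/le_anti/andP; split; last first.
  by apply: leB => _ [a Aa <-]; rewrite leI2 // ubA.
set B := sub_sup _ in ubB *.
have [_ Simp] := sublocaleP S.
have SxB := Simp (\val x) _ (sub_localeP B).
suff : (sub_sup A <= sub_of SxB)%O.
  rewrite !sub_leE !sub_ofK le_limp; apply: le_trans.
  by rewrite meetC.
apply: leA => a Aa; rewrite sub_leE sub_ofK le_limp meetC.
have : ((x `&` a)%O <= B)%O by apply: ubB; exists a.
by rewrite sub_leE sub_ofK.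
Qed.

HB.instance Definition _ :=
  isLocale.Build d T sub_sup_supremums sub_meet_sup.

End SubLocale.

Section MaximalNowhereDense.
Context (d : Order.disp_t) (L : localeType d).

(* N is contained in S and, viewed as a subset N' of the locale S, is a nowhere
   dense sublocale of that locale. *)
Definition nowhere_dense_in (N S : sublocale L) :=
  N `<=` S /\
  exists N' : sublocale (sub_locale S),
    (N' = \val @^-1` N :> set (sub_locale S)) /\ nowhere_dense N'.

Definition maximal_nowhere_dense (N : sublocale L) :=
  nowhere_dense N /\
  ~ exists S : sublocale L, nowhere_dense S /\ nowhere_dense_in N S.

End MaximalNowhereDense.

Record localic_map (dL dM : Order.disp_t)
    (L : localeType dL) (M : localeType dM) := LocalicMap {
  localic_fun :> L -> M;
  localic_adj : M -> L;
  localic_linf : forall A : set L,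
    localic_fun (linf A) = linf (localic_fun @` A);
  localic_adjP : forall (x : L) (y : M),
    (localic_adj y <= x)%O = (y <= localic_fun x)%O;
  localic_adj1 : localic_adj \top%O = \top%O;
  localic_adjI : forall y z : M,
    localic_adj (y `&` z)%O = (localic_adj y `&` localic_adj z)%O
}.

Section LocalicMap.
Context (dL dM : Order.disp_t) (L : localeType dL) (M : localeType dM).
Variable f : localic_map L M.

Fact image_is_sublocale (S : sublocale L) : is_sublocale (f @` S).
Proof.
have [Sinf Simp] := sublocaleP S; split.
  move=> A AS; exists (linf [set s | sublocale_set S s /\ A (f s)]).
    by apply: Sinf => s [].
  rewrite localic_linf; congr linf; apply/seteqP; split=> [_ [s [_ As] <-]//|].
  by move=> a Aa; have [s Ss fsa] := AS a Aa; exists s; rewrite //= fsa.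
move=> y _ [s Ss <-]; exists (limp (localic_adj f y) s); first exact: Simp.
apply/le_anti/andP; split.
  rewrite le_limp -localic_adjP localic_adjI -le_limp localic_adjP.
  exact: lexx.
rewrite -localic_adjP le_limp -localic_adjI localic_adjP -le_limp.
exact: lexx.
Qed.

Definition image_sublocale (S : sublocale L) : sublocale M :=
  Sublocale (image_is_sublocale S).

Definition open_localic_map :=
  forall S : sublocale L,
    is_open_sublocale S -> is_open_sublocale (image_sublocale S).

End LocalicMap.

(* Main.v *)
Require Import Defs.
From mathcomp Require Import all_boot all_order.
From mathcomp Require Import boolp classical_sets.

(**
A sublocale [N] is nowhere dense iff its least element is dense, and is nowhere
dense in [S] iff [0_N -> 0_S = 0_S]. The least element of [f[N]] is [f 0_N], so
nowhere density passes to the image. If [f[N]] were nowhere dense in a nowhere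
dense [S] with least element [c], then [N] would be nowhere dense in the closed
sublocale above [f^* c], contradicting maximality: openness makes [f^*] preserve
the Heyting implication, hence [f^* c] is dense, and
[0_N -> f^* c <= f^* (f 0_N) -> f^* c = f^* (f 0_N -> c) = f^* c].
*)

Set Implicit Arguments.
Unset Strict Implicit.
Unset Printing Implicit Defensive.

Import Order.TTheory.

Local Open Scope classical_set_scope.

Section LocaleTheory.
Context (d : Order.disp_t) (L : localeType d).
Implicit Types (a s u v x y z : L) (N S : sublocale L).

Lemma limp_meet_le x y : (limp x y `&` x <= y)%O.
Proof. by rewrite -le_limp. Qed.

Lemma le_limpr x y : (y <= limp x y)%O.
Proof. by rewrite le_limp leIl. Qed.

Lemma le_limp2l x y z : (x <= y)%O -> (limp y z <= limp x z)%O.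
Proof. by move=> xy; rewrite le_limp; apply: le_trans (limp_meet_le y z); rewrite leI2. Qed.

(** Since [x] meets [pcompl x] in bottom, lying below [x] and [pcompl x] means being bottom. This
    places the double pseudocomplement of [x] in every sublocale containing [x]. *)
Lemma limp_pcompl x : limp (pcompl x) x = pcompl (pcompl x).
Proof.
apply/le_anti/andP; split; last first.
  by rewrite le_limp (le_trans (limp_meet_le _ _)) ?le0x.
rewrite /pcompl [X in (_ <= X)%O]/limp; apply: lsup_ub => /=.
apply: le_trans (limp_meet_le x \bot%O); rewrite -/(pcompl x) lexI leIr /=.
exact: limp_meet_le.
Qed.

Lemma sublocale_linf S : sublocale_set S (linf S).
Proof. by case: (sublocaleP S) => Sinf _; exact: Sinf. Qed.

Lemma sublocale_limp S x y : sublocale_set S y -> sublocale_set S (limp x y).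
Proof. by case: (sublocaleP S) => _; apply. Qed.

Lemma sublocale_top S : sublocale_set S \top%O.
Proof. exact: sub_top_subproof. Qed.

Lemma nowhere_denseP N : nowhere_dense N <-> dense (linf N).
Proof.
split=> [NB|Nd].
  (* The double pseudocomplement of [linf N] lies in both sets, so it is top and [pcompl (linf N)]
     is bottom. *)
  have : (N `&` @booleanization d L) (limp (pcompl (linf N)) (linf N)).
    split; first by apply: sublocale_limp; exact: sublocale_linf.
    by rewrite limp_pcompl; exists (pcompl (linf N)).
  rewrite NB limp_pcompl => ppN1; apply/le_anti; rewrite le0x andbT.
  apply: le_trans (limp_meet_le (pcompl (linf N)) \bot%O).
  by rewrite lexI lexx andbT -/(pcompl _) ppN1 lex1.
apply/seteqP; split=> [y [Ny [x _ xy]]|_ ->]; last first.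
  split; first exact: sublocale_top.
  by exists \bot%O => //; apply/le_anti; rewrite lex1 le_limp leIr.
(* From [linf N <= y = pcompl x] follows [x <= pcompl (linf N)], which is bottom; hence [y] is
   top. *)
apply/le_anti; rewrite lex1 -xy le_limp meetC meetx1 -Nd le_limp meetC -le_limp.
by rewrite -/(pcompl x) xy linf_lb.
Qed.

(* The open sublocale of [v] determines the nucleus [v -> _]. *)
Lemma meet_le_open v y z :
  (v `&` y <= z)%O <-> (forall t, open_set v t -> (z <= t)%O -> (y <= t)%O).
Proof.
split=> [vyz _ [x _ <-] zx|yz].
  rewrite le_limp; apply: le_trans (limp_meet_le v x).
  by rewrite lexI leIr andbT meetC (le_trans vyz).
rewrite meetC -le_limp; apply: yz; last exact: le_limpr.
by exists z.
Qed.

Fact open_is_sublocale u : is_sublocale (open_set u).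
Proof.
(* [limp u] is idempotent, so its image consists of fixed points. *)
have fixE s : open_set u s -> limp u s = s.
  case=> x _ <-; apply/le_anti; rewrite le_limpr andbT !le_limp.
  apply: le_trans (limp_meet_le u x).
  by rewrite lexI leIr andbT limp_meet_le.
split=> [A Au|x _ [s _ <-]].
  exists (linf A) => //; apply/le_anti; rewrite le_limpr andbT.
  apply: linf_ge => s As; rewrite -(fixE s (Au s As)) le_limp.
  exact: le_trans (limp_meet_le _ _) (linf_lb As).
exists (limp x s) => //; apply/le_anti/andP; split.
  by rewrite !le_limp meetAC -!le_limp.
by rewrite !le_limp meetAC -!le_limp.
Qed.

Fact closed_is_sublocale a : is_sublocale [set x | (a <= x)%O].
Proof.
split=> [A Aa|x s /= sa]; first by apply: linf_ge => x /Aa.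
exact: le_trans sa (le_limpr _ _).
Qed.

Definition closed_sublocale a := Sublocale (closed_is_sublocale a).

Lemma linf_closed a : linf (closed_sublocale a) = a.
Proof.
by apply/le_anti/andP; split; [apply: linf_lb => /= | apply: linf_ge].
Qed.

End LocaleTheory.

Section SubLocaleTheory.
Context (d : Order.disp_t) (L : localeType d) (S : sublocale L).
Local Notation T := (sub_locale S).
Implicit Types (x y : T) (A : set T).

Lemma val_linf A : \val (linf A) = linf [set \val x | x in A].
Proof.
have SA : sublocale_set S (linf [set \val x | x in A]).
  by case: (sublocaleP S) => Sinf _; apply: Sinf => _ [x _ <-]; exact: sub_localeP.
apply/le_anti/andP; split.
  by apply: linf_ge => _ [x Ax <-]; rewrite -sub_leE linf_lb.
rewrite -(sub_ofK SA) -sub_leE; apply: linf_ge => x Ax.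
by rewrite sub_leE sub_ofK; apply: linf_lb; exists x.
Qed.

Lemma val_limp x y : \val (limp x y) = limp (\val x) (\val y).
Proof.
have valI u v : \val (u `&` v : T)%O = (\val u `&` \val v)%O by exact: sub_ofK.
apply/le_anti/andP; split.
  by rewrite le_limp -valI -sub_leE limp_meet_le.
have Sxy := sublocale_limp (\val x) (sub_localeP y).
by rewrite -(sub_ofK Sxy) -sub_leE le_limp sub_leE valI sub_ofK limp_meet_le.
Qed.

Lemma val_bot : \val (\bot%O : T) = linf S.
Proof.
apply/le_anti/andP; split; last by apply: linf_lb; exact: sub_localeP.
by rewrite -(sub_ofK (sublocale_linf S)) -sub_leE le0x.
Qed.

Lemma sub_preimage_is_sublocale (N : sublocale L) :
  is_sublocale ((\val : T -> L) @^-1` N).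
Proof.
case: (sublocaleP N) => Ninf Nimp; split=> [A AN|x s Ns]; rewrite /preimage /mkset.
  by rewrite val_linf; apply: Ninf => _ [x /AN Nx <-].
by rewrite val_limp; exact: Nimp.
Qed.

(** Infima and implications of [S] are those of [L], but its bottom is [linf S]; the right side is
    density of the least element of [N], computed in [S]. *)
Lemma nowhere_dense_inP (N : sublocale L) : N `<=` S ->
  nowhere_dense_in N S <-> limp (linf N) (linf S) = linf S.
Proof.
move=> NS.
have valN : [set \val x | x in (\val : T -> L) @^-1` N] = N :> set L.
  apply/seteqP; split=> [_ [x Nx <-]//|x Nx].
  by exists (sub_of (NS x Nx)); rewrite /= ?sub_ofK.
have densE : dense (linf ((\val : T -> L) @^-1` N)) <->
             limp (linf N) (linf S) = linf S.
  have <- : \val (linf ((\val : T -> L) @^-1` N)) = linf N by rewrite val_linf valN.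
  rewrite -val_bot -val_limp; split=> [Nd|/val_inj //].
  by congr (\val _).
split=> [[_ [N' [N'E /nowhere_denseP]]]|/densE Nd].
  by rewrite N'E => /densE.
split=> //; exists (Sublocale (sub_preimage_is_sublocale N)); split=> //.
exact/nowhere_denseP.
Qed.

End SubLocaleTheory.

Section LocalicMapTheory.
Context (dL dM : Order.disp_t) (L : localeType dL) (M : localeType dM).
Variable f : localic_map L M.

Lemma linf_image (N : sublocale L) : linf (image_sublocale f N) = f (linf N).
Proof. by rewrite localic_linf. Qed.

Lemma localic_adj_bot : localic_adj f \bot%O = \bot%O.
Proof. by apply/le_anti; rewrite le0x andbT localic_adjP le0x. Qed.

Lemma localic_adj_fun x : (localic_adj f (f x) <= x)%O.
Proof. by rewrite localic_adjP. Qed.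

Hypothesis f_open : open_localic_map f.

(* [v] below, with [f[o(u)] = o(v)], is the value at [u] of the left adjoint of
   [f^*]; the equivalence is the Frobenius law in adjoint form. *)
Lemma open_adj_frobenius (u : L) : exists v : M, forall y z,
  (u `&` localic_adj f y <= localic_adj f z)%O <-> (v `&` y <= z)%O.
Proof.
have [v fuv] : is_open_sublocale (image_sublocale f (Sublocale (open_is_sublocale u))).
  by apply: f_open; exists u.
(* Elements of [o(v)] are the [f s] with [s] in [o(u)], and the adjunction trades [z <= f s] for
   [f^* z <= s]. *)
exists v => y z; rewrite !meet_le_open -fuv /=.
split=> [uyz _ [s us <-]|vyz s us]; rewrite -?localic_adjP; first exact: uyz.
by rewrite !localic_adjP; apply: vyz; exists s.
Qed.

Lemma open_adj_limp (y z : M) :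
  (limp (localic_adj f y) (localic_adj f z) <= localic_adj f (limp y z))%O.
Proof.
set u := limp _ _; have [v uv] := open_adj_frobenius u.
have vyz : (v <= limp y z)%O by rewrite le_limp; apply/uv; exact: limp_meet_le.
(* At top the Frobenius law becomes the adjunction [u <= f^* z] iff [v <= z]. *)
have := uv \top%O (limp y z); rewrite localic_adj1 !meetx1 => uvE.
exact/uvE.
Qed.

Lemma open_adj_dense (y : M) : dense y -> dense (localic_adj f y).
Proof.
move=> yd; apply/le_anti; rewrite le0x andbT /pcompl -localic_adj_bot.
by apply: le_trans (open_adj_limp _ _) _; rewrite -/(pcompl y) yd.
Qed.

End LocalicMapTheory.

Theorem proposition6p3 (dL dM : Order.disp_t)
    (L : localeType dL) (M : localeType dM) (f : localic_map L M)
    (f_open : open_localic_map f)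
    (f_dense : forall a : L, dense a -> dense (f a))
    (N : sublocale L) :
  maximal_nowhere_dense N -> maximal_nowhere_dense (image_sublocale f N).
Proof.
case=> /nowhere_denseP Nd Nmax; split.
  by apply/nowhere_denseP; rewrite linf_image; exact: f_dense.
case=> S [/nowhere_denseP Sd NinS]; have NS := NinS.1.
move/(nowhere_dense_inP NS): NinS; rewrite linf_image => fNS.
set c := linf S in Sd fNS; set b := localic_adj f c.
apply: Nmax; exists (closed_sublocale b); split.
  by apply/nowhere_denseP; rewrite linf_closed; exact: open_adj_dense.
have Nb : N `<=` closed_sublocale b.
  (* By adjunction, [b <= x] says [c <= f x], and [f x] lies in [S]. *)
  move=> x Nx /=; rewrite /b localic_adjP; apply: linf_lb; apply: NS.
  by exists x.
apply/(nowhere_dense_inP Nb); rewrite linf_closed.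
apply/le_anti; rewrite le_limpr andbT.
(* Implication is antitone in its premise, and [f^* (f 0_N) <= 0_N]. *)
apply: le_trans (le_limp2l _ (localic_adj_fun f _)) _.
by apply: le_trans (open_adj_limp f_open _ _) _; rewrite fNS.
Qed.
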